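(* Let $\alpha,\beta,\gamma\in\mathbb{C}$ and consider the functions below on $|x|<1$, $|y|<1$. (i) If $q^\gamma\notin\{1,q^{-1},q^{-2},\dots\}$, then, with $\mathbf{\Phi}_i=\mathbf{\Phi}_i(q^\alpha,q^\beta;q^\gamma;q,x,y)$ for $i=1,2$, $$\Big([\mathbf{\Theta}_{x,q}]_{q}[\mathbf{\Theta}_{x,q}+\mathbf{\Theta}_{y,q}+\gamma-1]_{q}-x[\mathbf{\Theta}_{x,q}+\mathbf{\Theta}_{y,q}+\alpha]_{q}[\mathbf{\Theta}_{x,q}+\beta]_{q}\Big)\mathbf{\Phi}_{1}=0,$$ $$\Big([\mathbf{\Theta}_{y,q}]_{q}[\mathbf{\Theta}_{x,q}+\mathbf{\Theta}_{y,q}+\gamma-1]_{q}-\frac{y}{1-q}[\mathbf{\Theta}_{x,q}+\mathbf{\Theta}_{y,q}+\alpha]_{q}\Big)\mathbf{\Phi}_{1}=0,$$ $$\Big([\mathbf{\Theta}_{x,q}]_{q}[\mathbf{\Theta}_{x,q}+\mathbf{\Theta}_{y,q}+\gamma-1]_{q}-\frac{x}{1-q}[\mathbf{\Theta}_{x,q}+\alpha]_{q}\Big)\mathbf{\Phi}_{2}=0,$$ $$\Big([\mathbf{\Theta}_{y,q}]_{q}[\mathbf{\Theta}_{x,q}+\mathbf{\Theta}_{y,q}+\gamma-1]_{q}-\frac{y}{1-q}[\mathbf{\Theta}_{y,q}+\beta]_{q}\Big)\mathbf{\Phi}_{2}=0.$$ (ii) If $q^\beta\notin\{1,q^{-1},q^{-2},\dots\}$,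 then, with $\mathbf{\Phi}_3=\mathbf{\Phi}_3(q^\alpha;q^\beta;q,x,y)$, $$\Big([\mathbf{\Theta}_{x,q}]_{q}[\mathbf{\Theta}_{x,q}+\mathbf{\Theta}_{y,q}+\beta-1]_{q}-\frac{x}{1-q}[\mathbf{\Theta}_{x,q}+\alpha]_{q}\Big)\mathbf{\Phi}_{3}=0,$$ $$\Big([\mathbf{\Theta}_{y,q}]_{q}[\mathbf{\Theta}_{x,q}+\mathbf{\Theta}_{y,q}+\beta-1]_{q}-\frac{y}{(1-q)^{2}}\Big)\mathbf{\Phi}_{3}=0.$$
   Context: Fix $q\in\mathbb{C}$ with $0<|q|<1$ and a choice of $\log q$, so that $q^{z}=e^{z\log q}$ for $z\in\mathbb{C}$. Put $[z]_q=\frac{1-q^z}{1-q}$. The $q$-shifted factorial is $(a;q)_0=1$, $(a;q)_\ell=\prod_{j=0}^{\ell-1}(1-aq^j)$ for $\ell\ge 1$. The basic Humbert functions are, for $|x|<1,|y|<1$, $$\mathbf{\Phi}_{1}(q^{\alpha},q^{\beta};q^{\gamma};q,x,y)=\sum_{n,k=0}^{\infty}\frac{(q^{\alpha};q)_{n+k}(q^{\beta};q)_{n}}{(q^{\gamma};q)_{n+k}(q;q)_{n}(q;q)_{k}}x^{n}y^{k},$$ $$\mathbf{\Phi}_{2}(q^{\alpha},q^{\beta};q^{\gamma};q,x,y)=\sum_{n,k=0}^{\infty}\frac{(q^{\alpha};q)_{n}(q^{\beta};q)_{k}}{(q^{\gamma};q)_{n+k}(q;q)_{n}(q;q)_{k}}x^{n}y^{k},$$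 $$\mathbf{\Phi}_{3}(q^{\alpha};q^{\beta};q,x,y)=\sum_{n,k=0}^{\infty}\frac{(q^{\alpha};q)_{n}}{(q^{\beta};q)_{n+k}(q;q)_{n}(q;q)_{k}}x^{n}y^{k},$$ defined when the denominator parameter ($q^\gamma$ for $\mathbf\Phi_1,\mathbf\Phi_2$; $q^\beta$ for $\mathbf\Phi_3$) is not in $\{1,q^{-1},q^{-2},\dots\}$. The operators $q^{\mathbf{\Theta}_{x,q}}$ and $q^{\mathbf{\Theta}_{y,q}}$ are by convention the dilations $f(x,y)\mapsto f(qx,y)$ and $f(x,y)\mapsto f(x,qy)$. For $c\in\mathbb{C}$, $a,b\in\{0,1\}$, the operator $[a\mathbf{\Theta}_{x,q}+b\mathbf{\Theta}_{y,q}+c]_q$ is $f(x,y)\mapsto\frac{f(x,y)-q^cf(q^ax,q^by)}{1-q}$; it multiplies $x^ny^k$ by $[an+bk+c]_q$. Products of operators are compositions, and $x$, $y$ standing to the left denote multiplication by $x$, $y$ applied last. *)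

(* Defs.v *)
From Stdlib Require Import Reals.
From Coquelicot Require Import Coquelicot.

Local Open Scope C_scope.

Definition Cexp (z : C) : C :=
  ((exp (Re z) * cos (Im z))%R, (exp (Re z) * sin (Im z))%R).

(* q^z, where L is the chosen logarithm of q. *)
Definition qpow (L z : C) : C := Cexp (z * L).

Fixpoint qpoch (a q : C) (l : nat) : C :=
  match l with
  | O => 1
  | S j => qpoch a q j * (1 - a * q ^ j)
  end.

(* The double series converges to s when its rectangular partial sums
   (n <= N, k <= K) tend to s as N and K tend to infinity independently. *)
Definition is_dseries (u : nat -> nat -> C) (s : C) : Prop :=
  filterlim
    (fun NK : nat * nat =>
       sum_n (fun n => sum_n (fun k => u n k) (snd NK)) (fst NK))
    (filter_prod eventually eventually) (locally s).

Definition dseries (u : nat -> nat -> C) : C :=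
  @iota C_CompleteNormedModule (is_dseries u).

Lemma dseries_unique (u : nat -> nat -> C) (s : C) :
  is_dseries u s -> dseries u = s.
Proof.
intros H.
exact (@iota_filterlim_locally C_AbsRing C_CompleteNormedModule _ _ _ _ s H).
Qed.

(* In the three functions below the parameters a, b, c are the values
   q^alpha, q^beta, q^gamma (for Phi3: a = q^alpha and b = q^beta). *)

Definition Phi1 (a b c q x y : C) : C :=
  dseries (fun n k =>
    qpoch a q (n + k) * qpoch b q n
    / (qpoch c q (n + k) * qpoch q q n * qpoch q q k) * x ^ n * y ^ k).

Definition Phi2 (a b c q x y : C) : C :=
  dseries (fun n k =>
    qpoch a q n * qpoch b q k
    / (qpoch c q (n + k) * qpoch q q n * qpoch q q k) * x ^ n * y ^ k).

Definition Phi3 (a b q x y : C) : C :=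
  dseries (fun n k =>
    qpoch a q n
    / (qpoch b q (n + k) * qpoch q q n * qpoch q q k) * x ^ n * y ^ k).

(* The operator [a Theta_x + b Theta_y + c]_q. *)
Definition qTheta (q L : C) (a b : nat) (c : C) (f : C -> C -> C) : C -> C -> C :=
  fun x y => (f x y - qpow L c * f (q ^ a * x) (q ^ b * y)) / (1 - q).

(* z is not one of 1, q^(-1), q^(-2), ... *)
Definition admissible (q z : C) : Prop := forall m : nat, z <> / q ^ m.

(* Main.v *)
Require Import Defs.
From Stdlib Require Import Reals Lra Lia.
From Coquelicot Require Import Coquelicot.

Local Open Scope C_scope.

(* Each of the three functions is the sum of a double power series with bounded
   coefficients, because the products [qpoch a q l] and [/ qpoch c q l] are
   bounded in [l].  Such series converge on the open bidisc and [qTheta] acts on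
   them diagonally, multiplying the coefficient of [x^n y^k] by
   [[a n + b k + c]_q].  Multiplication by [x] or [y] shifts one index, and the
   factors [[n]_q [n + k + gamma - 1]_q] (resp. [[k]_q ...]) cancel exactly the
   factors gained by the denominator under this shift, and vanish at index 0. *)

(** * Finite complex sums and geometric majorants *)

Lemma sum_n_Cmult_l (c : C) (u : nat -> C) (n : nat) :
  sum_n (fun k => c * u k) n = c * sum_n u n.
Proof. exact (sum_n_mult_l c u n). Qed.

Lemma sum_n_Cminus (u v : nat -> C) (n : nat) :
  sum_n (fun k => u k - v k) n = sum_n u n - sum_n v n.
Proof.
induction n as [|n IH].
- now rewrite !sum_O.
- rewrite !sum_Sn, IH.
  change (sum_n u n - sum_n v n + (u (S n) - v (S n))
    = sum_n u n + u (S n) - (sum_n v n + v (S n))).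
  ring.
Qed.

Lemma sum_n_S_l (u : nat -> C) (n : nat) :
  sum_n u (S n) = u 0%nat + sum_n (fun k => u (S k)) n.
Proof.
induction n as [|n IH].
- now rewrite sum_Sn, !sum_O.
- rewrite sum_Sn, IH, (sum_Sn (fun k => u (S k))).
  change (u 0%nat + sum_n (fun k => u (S k)) n + u (S (S n))
    = u 0%nat + (sum_n (fun k => u (S k)) n + u (S (S n)))).
  ring.
Qed.

(** The induction needs the exact geometric sum [c / (1 - r) * (1 - r ^ S n)]; the last factor is
    dropped only at the end. *)
Lemma sum_n_geom_bound (u : nat -> C) (c r : R) (n : nat) :
  (0 <= c)%R -> (0 <= r < 1)%R ->
  (forall k, Cmod (u k) <= c * r ^ k)%R ->
  (Cmod (sum_n u n) <= c / (1 - r))%R.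
Proof.
intros hc hr hu.
assert (h : (Cmod (sum_n u n) <= c / (1 - r) * (1 - r ^ S n))%R).
{ induction n as [|n IH].
  - rewrite sum_O. apply Rle_trans with (1 := hu 0%nat).
    right. simpl. field. lra.
  - rewrite sum_Sn. apply Rle_trans with (1 := Cmod_triangle _ _).
    apply Rle_trans with (1 := Rplus_le_compat _ _ _ _ IH (hu (S n))).
    right. simpl. field. lra. }
apply Rle_trans with (1 := h).
assert (0 <= c / (1 - r))%R by (apply Rdiv_le_0_compat; lra).
assert (0 <= r ^ S n)%R by (apply pow_le; lra).
nra.
Qed.

(** The induction carries the exact difference [r ^ S m - r ^ S n]; the coarser [r ^ m] suffices for
    the Cauchy estimate below. *)
Lemma sum_n_geom_tail (u : nat -> C) (c r : R) (m n : nat) :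
  (0 <= c)%R -> (0 <= r < 1)%R ->
  (forall k, Cmod (u k) <= c * r ^ k)%R -> (m <= n)%nat ->
  (Cmod (sum_n u n - sum_n u m) <= c / (1 - r) * r ^ m)%R.
Proof.
intros hc hr hu hmn.
assert (0 <= c / (1 - r))%R by (apply Rdiv_le_0_compat; lra).
assert (h : (Cmod (sum_n u n - sum_n u m)
             <= c / (1 - r) * (r ^ S m - r ^ S n))%R).
{ induction hmn as [|n hmn IH].
  - replace (sum_n u m - sum_n u m) with (RtoC 0) by ring.
    rewrite Cmod_0. lra.
  - rewrite sum_Sn.
    replace (plus (sum_n u n) (u (S n)) - sum_n u m)
      with (sum_n u n - sum_n u m + u (S n))
      by (change (plus (sum_n u n) (u (S n))) with (sum_n u n + u (S n)); ring).
    apply Rle_trans with (1 := Cmod_triangle _ _).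
    apply Rle_trans with (1 := Rplus_le_compat _ _ _ _ IH (hu (S n))).
    right. simpl. field. lra. }
apply Rle_trans with (1 := h).
apply Rmult_le_compat_l; [assumption|].
assert (0 <= r ^ S n)%R by (apply pow_le; lra).
assert (0 <= r ^ m)%R by (apply pow_le; lra).
simpl in *. nra.
Qed.

(** * Convergence and algebra of double series *)

(** The rectangular partial sums are Cauchy: large rectangles are compared with one fixed corner
    rectangle, and the excess is a tail in [k] plus a tail in [n], both geometric. *)
Lemma ex_dseries_geom (u : nat -> nat -> C) (M r s : R) :
  (0 <= M)%R -> (0 <= r < 1)%R -> (0 <= s < 1)%R ->
  (forall n k, Cmod (u n k) <= M * r ^ n * s ^ k)%R ->
  exists l, is_dseries u l.
Proof.
intros hM hr hs hu.
set (P := fun N K => sum_n (fun n => sum_n (fun k => u n k) K) N).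
set (D := (M / (1 - s) / (1 - r))%R).
assert (hMs : (0 <= M / (1 - s))%R) by (apply Rdiv_le_0_compat; lra).
assert (hD : (0 <= D)%R) by (apply Rdiv_le_0_compat; lra).
assert (hpow : forall n, (0 <= r ^ n)%R) by (intros; apply pow_le; lra).
assert (hspow : forall n, (0 <= s ^ n)%R) by (intros; apply pow_le; lra).
assert (hrow : forall N0 K0 N K, (N0 <= N)%nat -> (K0 <= K)%nat ->
  (Cmod (P N K - P N0 K0) <= D * s ^ K0 + D * r ^ N0)%R).
{ intros N0 K0 N K hN hK.
  (* Change [K] at fixed [N], then [N] at fixed [K0]: the first difference is a sum over [n] of
     tails in [k], the second a tail over [n] of row sums. *)
  replace (P N K - P N0 K0) with ((P N K - P N K0) + (P N K0 - P N0 K0)) by ring.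
  apply Rle_trans with (1 := Cmod_triangle _ _).
  apply Rplus_le_compat.
  - unfold P. rewrite <- sum_n_Cminus.
    apply Rle_trans with (M / (1 - s) * s ^ K0 / (1 - r))%R.
    + apply sum_n_geom_bound; trivial.
      { now apply Rmult_le_pos. }
      intros n.
      apply Rle_trans with (M * r ^ n / (1 - s) * s ^ K0)%R.
      * apply sum_n_geom_tail; auto. now apply Rmult_le_pos.
      * right. field. lra.
    + right. unfold D. field. lra.
  - unfold P, D. apply sum_n_geom_tail; trivial.
    intros n.
    apply Rle_trans with (M * r ^ n / (1 - s))%R.
    + apply sum_n_geom_bound; auto. now apply Rmult_le_pos.
    + right. field. lra. }
unfold is_dseries.
apply (proj1 (@filterlim_locally_cauchy _ C_CompleteNormedModule _
  _
  (fun NK : nat * nat => P (fst NK) (snd NK)))).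
intros eps.
(* Two rectangles, each compared with the corner one, give four error terms below [eps / 4]; [D + 1]
   avoids division by zero when [D = 0]. *)
assert (he : (0 < eps / (4 * (D + 1)))%R).
{ apply Rdiv_lt_0_compat; [apply cond_pos | lra]. }
assert (small : forall t, (0 <= t < 1)%R ->
  exists N, (D * t ^ N < eps / 4)%R).
{ intros t ht.
  destruct (pow_lt_1_zero t) with (y := (eps / (4 * (D + 1)))%R) as [N hN]; trivial.
  { rewrite Rabs_pos_eq; lra. }
  exists N.
  specialize (hN N (le_n N)).
  assert (ht' : (0 <= t ^ N)%R) by (apply pow_le; lra).
  rewrite Rabs_pos_eq in hN by trivial.
  apply Rle_lt_trans with ((D + 1) * t ^ N)%R; [nra|].
  replace (eps / 4)%R with ((D + 1) * (eps / (4 * (D + 1))))%R by (field; lra).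
  apply Rmult_lt_compat_l; lra. }
destruct (small r hr) as [N0 hN0].
destruct (small s hs) as [K0 hK0].
exists (fun NK => (N0 <= fst NK)%nat /\ (K0 <= snd NK)%nat).
split.
- exists (fun N => (N0 <= N)%nat) (fun K => (K0 <= K)%nat).
  + now exists N0.
  + now exists K0.
  + now simpl.
- intros [N K] [N' K'] [h1 h2] [h3 h4]. simpl in *.
  apply C_NormedModule_mixin_compat1.
  change (Cmod (P N' K' - P N K) < eps)%R.
  replace (P N' K' - P N K)
    with ((P N' K' - P N0 K0) + - (P N K - P N0 K0)) by ring.
  apply Rle_lt_trans with (1 := Cmod_triangle _ _).
  rewrite Cmod_opp.
  assert (a1 := hrow N0 K0 N K h1 h2).
  assert (a2 := hrow N0 K0 N' K' h3 h4).
  assert (0 < eps)%R by apply cond_pos.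
  lra.
Qed.

Lemma is_dseries_ext (u v : nat -> nat -> C) (s : C) :
  (forall n k, u n k = v n k) -> is_dseries u s -> is_dseries v s.
Proof.
intros huv. unfold is_dseries.
apply filterlim_ext. intros [N K].
apply sum_n_ext. intros n. apply sum_n_ext. intros k. apply huv.
Qed.

Lemma is_dseries_Cmult (c : C) (u : nat -> nat -> C) (s : C) :
  is_dseries u s -> is_dseries (fun n k => c * u n k) (c * s).
Proof.
intros hu.
apply (filterlim_ext (fun NK : nat * nat =>
  c * sum_n (fun n => sum_n (fun k => u n k) (snd NK)) (fst NK))).
{ intros [N K]. rewrite <- sum_n_Cmult_l.
  apply sum_n_ext. intros n. now rewrite sum_n_Cmult_l. }
apply filterlim_comp with (1 := hu).
exact (@filterlim_scal_r C_AbsRing C_NormedModule c s).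
Qed.

Lemma is_dseries_Cminus (u v : nat -> nat -> C) (s t : C) :
  is_dseries u s -> is_dseries v t ->
  is_dseries (fun n k => u n k - v n k) (s - t).
Proof.
intros hu hv.
assert (hv' := is_dseries_Cmult (-1) v t hv).
replace (s - t) with (s + -1 * t) by ring.
apply (filterlim_ext (fun NK : nat * nat =>
  sum_n (fun n => sum_n (fun k => u n k) (snd NK)) (fst NK) +
  sum_n (fun n => sum_n (fun k => -1 * v n k) (snd NK)) (fst NK))).
{ intros [N K]. simpl.
  rewrite <- (sum_n_plus (G := C_AbelianMonoid)).
  apply sum_n_ext. intros n.
  rewrite <- (sum_n_plus (G := C_AbelianMonoid)).
  apply sum_n_ext. intros k.
  change (u n k + -1 * v n k = u n k - v n k). ring. }
exact (filterlim_comp_2 _ _ _ hu hv'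
  (@filterlim_plus C_AbsRing C_NormedModule s (-1 * t))).
Qed.

Lemma is_dseries_unique (u : nat -> nat -> C) (s t : C) :
  is_dseries u s -> is_dseries u t -> s = t.
Proof.
intros hs ht.
now rewrite <- (dseries_unique u s hs), <- (dseries_unique u t ht).
Qed.

(** As the row at index 0 vanishes, the partial sum of [u] up to [S N] is that of the shifted array
    up to [N]. This is multiplication by [x] at the level of series. *)
Lemma is_dseries_shift_l (u : nat -> nat -> C) (s : C) :
  (forall k, u 0%nat k = 0) ->
  is_dseries (fun n k => u (S n) k) s -> is_dseries u s.
Proof.
intros hu0 hs P HP.
destruct (hs P HP) as [Q R [N0 hQ] hR hP].
exists (fun N => (S N0 <= N)%nat) R; trivial.
{ now exists (S N0). }
intros N K hN hK. destruct N as [|N]; [lia|]. simpl.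
rewrite sum_n_S_l.
(* Writing the zero row as [0 * 0] lets a constant 0 be pulled out of its sum. *)
rewrite (sum_n_ext (u 0%nat) (fun _ => 0 * 0)), sum_n_Cmult_l
  by (intros k; rewrite hu0; symmetry; apply Cmult_0_l).
rewrite Cmult_0_l, Cplus_0_l.
apply (hP N K); trivial. apply hQ. lia.
Qed.

(** Finite sums can be exchanged and the two bounds tend to infinity independently, so the limit is
    symmetric in the indices. *)
Lemma is_dseries_swap (u : nat -> nat -> C) (s : C) :
  is_dseries u s -> is_dseries (fun k n => u n k) s.
Proof.
intros hs P HP.
destruct (hs P HP) as [Q R hQ hR hP].
exists R Q; trivial.
intros K N hK hN. simpl. rewrite sum_n_switch.
now apply (hP N K).
Qed.

Lemma is_dseries_shift_r (u : nat -> nat -> C) (s : C) :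
  (forall n, u n 0%nat = 0) ->
  is_dseries (fun n k => u n (S k)) s -> is_dseries u s.
Proof.
intros hu0 hs.
apply (is_dseries_swap (fun k n => u n k)).
apply is_dseries_shift_l; trivial.
now apply is_dseries_swap in hs.
Qed.

(** * Double power series on the open bidisc *)

Definition has_dpseries (A : nat -> nat -> C) (F : C -> C -> C) : Prop :=
  forall x y, (Cmod x < 1)%R -> (Cmod y < 1)%R ->
  is_dseries (fun n k => A n k * x ^ n * y ^ k) (F x y).

Lemma has_dpseries_bounded (A : nat -> nat -> C) (M : R) :
  (forall n k, Cmod (A n k) <= M)%R ->
  has_dpseries A (fun x y => dseries (fun n k => A n k * x ^ n * y ^ k)).
Proof.
intros hA x y hx hy.
destruct (ex_dseries_geom (fun n k => A n k * x ^ n * y ^ k) M (Cmod x) (Cmod y))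
  as [l hl].
- apply Rle_trans with (2 := hA 0%nat 0%nat). apply Cmod_ge_0.
- split; [apply Cmod_ge_0 | trivial].
- split; [apply Cmod_ge_0 | trivial].
- intros n k. rewrite !Cmod_mult, !Cmod_pow.
  apply Rmult_le_compat_r; [apply pow_le, Cmod_ge_0|].
  apply Rmult_le_compat_r; [apply pow_le, Cmod_ge_0|].
  apply hA.
- now rewrite (dseries_unique _ _ hl).
Qed.

Lemma Cmod_dilate (q x : C) (a : nat) :
  (Cmod q < 1)%R -> (Cmod x < 1)%R -> (Cmod (q ^ a * x) < 1)%R.
Proof.
intros hq hx. rewrite Cmod_mult, Cmod_pow.
assert (h0 := Cmod_ge_0 q). assert (h1 := Cmod_ge_0 x).
assert (0 <= Cmod q ^ a <= 1)%R.
{ split; [now apply pow_le|].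
  rewrite <- (pow1 a). apply pow_incr. lra. }
nra.
Qed.

(** Dilation multiplies the term in [x ^ n * y ^ k] by [q ^ (a * n + b * k)] and keeps the point in
    the bidisc, so the two convergent series can be subtracted termwise. *)
Lemma has_dpseries_qTheta (q L : C) (a b : nat) (c : C) A F :
  (Cmod q < 1)%R -> has_dpseries A F ->
  has_dpseries
    (fun n k => A n k * ((1 - qpow L c * q ^ (a * n + b * k)) / (1 - q)))
    (qTheta q L a b c F).
Proof.
intros hq hF x y hx hy. unfold qTheta.
assert (h1 := hF x y hx hy).
assert (h2 := hF (q ^ a * x) (q ^ b * y)
  (Cmod_dilate q x a hq hx) (Cmod_dilate q y b hq hy)).
assert (h3 := is_dseries_Cmult (/ (1 - q)) _ _
  (is_dseries_Cminus _ _ _ _ h1 (is_dseries_Cmult (qpow L c) _ _ h2))).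
unfold Cdiv. rewrite Cmult_comm.
apply is_dseries_ext with (2 := h3).
intros n k. rewrite !Cpow_mult_l, Cpow_add_r, !Cpow_mult_r. ring.
Qed.

(** Both terms are sums of the same double series, so uniqueness of the limit turns a coefficient
    recursion into an equation of functions. The constant [c] makes room for powers of [/ (1 - q)]
    beside [x]. *)
Lemma dpseries_mult_x_eq A B F G (c x y : C) :
  has_dpseries A F -> has_dpseries B G ->
  (forall k, A 0%nat k = 0) -> (forall n k, A (S n) k = c * B n k) ->
  (Cmod x < 1)%R -> (Cmod y < 1)%R -> F x y - x * c * G x y = 0.
Proof.
intros hF hG h0 hS hx hy.
replace (F x y) with (x * c * G x y); [ring|].
apply (is_dseries_unique (fun n k => A n k * x ^ n * y ^ k)); [|now apply hF].
apply is_dseries_shift_l.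
{ intros k. rewrite h0. ring. }
apply is_dseries_ext with (2 := is_dseries_Cmult (x * c) _ _ (hG x y hx hy)).
intros n k. rewrite hS, Cpow_S. ring.
Qed.

Lemma dpseries_mult_y_eq A B F G (c x y : C) :
  has_dpseries A F -> has_dpseries B G ->
  (forall n, A n 0%nat = 0) -> (forall n k, A n (S k) = c * B n k) ->
  (Cmod x < 1)%R -> (Cmod y < 1)%R -> F x y - y * c * G x y = 0.
Proof.
intros hF hG h0 hS hx hy.
replace (F x y) with (y * c * G x y); [ring|].
apply (is_dseries_unique (fun n k => A n k * x ^ n * y ^ k)); [|now apply hF].
apply is_dseries_shift_r.
{ intros n. rewrite h0. ring. }
apply is_dseries_ext with (2 := is_dseries_Cmult (y * c) _ _ (hG x y hx hy)).
intros n k. rewrite hS, Cpow_S. ring.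
Qed.

(** * Boundedness of q-shifted factorials, their reciprocals and the coefficients *)

Lemma eventually_bounded_Cmod (u : nat -> C) (N : nat) (M : R) :
  (forall n, (N <= n)%nat -> (Cmod (u n) <= M)%R) ->
  exists M', forall n, (Cmod (u n) <= M')%R.
Proof.
revert M. induction N as [|N IH]; intros M hM.
- exists M. intros n. apply hM. lia.
- apply (IH (Rmax M (Cmod (u N)))). intros n hn.
  destruct (Nat.eq_dec n N) as [->|hne]; [apply Rmax_r|].
  apply Rle_trans with (2 := Rmax_l _ _). apply hM. lia.
Qed.

(* [1 + K r^l <= exp (K r^l)] turns the product into a geometric sum. *)
Lemma bounded_of_geom_growth (P : nat -> C) (K r : R) :
  (0 <= K)%R -> (0 <= r < 1)%R ->
  (forall l, Cmod (P (S l)) <= Cmod (P l) * (1 + K * r ^ l))%R ->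
  exists M, forall l, (Cmod (P l) <= M)%R.
Proof.
intros hK hr hP.
exists (Cmod (P 0%nat) * exp (K / (1 - r)))%R.
assert (h : forall l,
  (Cmod (P l) <= Cmod (P 0%nat) * exp (K / (1 - r) * (1 - r ^ l)))%R).
{ induction l as [|l IH].
  - simpl. rewrite Rminus_diag, Rmult_0_r, exp_0. lra.
  - apply Rle_trans with (1 := hP l).
    replace (K / (1 - r) * (1 - r ^ S l))%R
      with (K / (1 - r) * (1 - r ^ l) + K * r ^ l)%R by (simpl; field; lra).
    rewrite exp_plus, <- Rmult_assoc.
    apply Rmult_le_compat; trivial.
    + apply Cmod_ge_0.
    + assert (0 <= r ^ l)%R by (apply pow_le; lra). nra.
    + apply exp_ineq1_le. }
intros l. apply Rle_trans with (1 := h l).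
apply Rmult_le_compat_l; [apply Cmod_ge_0|].
apply Rnot_lt_le. intros hlt. apply exp_lt_inv in hlt.
assert (0 <= K / (1 - r))%R by (apply Rdiv_le_0_compat; lra).
assert (0 <= r ^ l)%R by (apply pow_le; lra).
nra.
Qed.

Lemma qpoch_bounded (a q : C) : (Cmod q < 1)%R ->
  exists M, forall l, (Cmod (qpoch a q l) <= M)%R.
Proof.
intros hq.
apply bounded_of_geom_growth with (Cmod a) (Cmod q).
- apply Cmod_ge_0.
- split; [apply Cmod_ge_0 | trivial].
- intros l. simpl. rewrite Cmod_mult.
  apply Rmult_le_compat_l; [apply Cmod_ge_0|].
  apply Rle_trans with (1 := Cmod_triangle _ _).
  rewrite Cmod_1, Cmod_opp, Cmod_mult, Cmod_pow. lra.
Qed.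

Lemma admissible_neq_0 (q c : C) (l : nat) :
  q <> 0 -> admissible q c -> 1 - c * q ^ l <> 0.
Proof.
intros hq hc h. apply (hc l).
assert (hl := Cpow_nz q l hq).
replace c with ((1 - (1 - c * q ^ l)) / q ^ l) by (field; trivial).
rewrite h. field. trivial.
Qed.

(** From [q = / q ^ m] would follow [q ^ S m = 1], impossible for modulus below 1. This is what
    makes every [qpoch q q n] nonzero. *)
Lemma admissible_base (q : C) : (0 < Cmod q)%R -> (Cmod q < 1)%R -> admissible q q.
Proof.
intros h0 h1 m h.
assert (hq : q <> 0) by now apply Cmod_gt_0.
assert (hm := Cpow_nz q m hq).
assert (e : q ^ S m = 1).
{ rewrite Cpow_S, h at 1. field. trivial. }
assert (e' : (Cmod q ^ S m)%R = 1%R).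
{ now rewrite <- Cmod_pow, e, Cmod_1. }
assert (Cmod q ^ m <= 1)%R.
{ rewrite <- (pow1 m). apply pow_incr. lra. }
simpl in e'. nra.
Qed.

Lemma qpoch_neq_0 (q c : C) (l : nat) :
  q <> 0 -> admissible q c -> qpoch c q l <> 0.
Proof.
intros hq hc. induction l as [|l IH].
- exact C1_nz.
- apply Cmult_neq_0; trivial. now apply admissible_neq_0.
Qed.

(** With [z = c * q ^ l] one has [1 / (1 - z) = 1 + z / (1 - z)], so a uniform bound [D] on
    [1 / (1 - z)] gives growth factors at most [1 + Cmod c * D * Cmod q ^ l]. *)
Lemma inv_qpoch_bounded (q c : C) :
  (0 < Cmod q)%R -> (Cmod q < 1)%R -> admissible q c ->
  exists M, forall l, (Cmod (/ qpoch c q l) <= M)%R.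
Proof.
intros h0 h1 hc.
assert (hq : q <> 0) by now apply Cmod_gt_0.
assert (hD : exists D, forall l, (Cmod (/ (1 - c * q ^ l)) <= D)%R).
(* Past [N], [Cmod (c * q ^ n)] is at most 1/2, whence the bound 2; the finitely many earlier
   factors only enlarge the constant. The [+ 1] covers [c = 0]. *)
{ destruct (pow_lt_1_zero (Cmod q)) with (y := (/ (2 * (Cmod c + 1)))%R)
    as [N hN].
  { rewrite Rabs_pos_eq; lra. }
  { apply Rinv_0_lt_compat. assert (h := Cmod_ge_0 c). lra. }
  apply eventually_bounded_Cmod with N 2%R. intros n hn.
  specialize (hN n hn).
  rewrite Rabs_pos_eq in hN by (apply pow_le; lra).
  assert (hcc := Cmod_ge_0 c).
  assert (hp : (0 <= Cmod q ^ n)%R) by (apply pow_le; lra).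
  assert (hz : (Cmod (c * q ^ n) <= / 2)%R).
  { rewrite Cmod_mult, Cmod_pow.
    apply Rle_trans with ((Cmod c + 1) * / (2 * (Cmod c + 1)))%R; [nra|].
    right. field. lra. }
  rewrite Cmod_inv by now apply admissible_neq_0.
  rewrite <- (Rinv_inv 2). apply Rinv_le_contravar; [lra|].
  assert (ht := Cmod_triangle (1 - c * q ^ n) (c * q ^ n)).
  replace (1 - c * q ^ n + c * q ^ n) with (RtoC 1) in ht by ring.
  rewrite Cmod_1 in ht. lra. }
destruct hD as [D hD].
assert (hD0 : (0 <= D)%R).
{ apply Rle_trans with (2 := hD 0%nat). apply Cmod_ge_0. }
apply bounded_of_geom_growth with (Cmod c * D)%R (Cmod q).
- apply Rmult_le_pos; [apply Cmod_ge_0 | trivial].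
- lra.
- intros l. simpl.
  assert (hl := admissible_neq_0 q c l hq hc).
  assert (hpl := qpoch_neq_0 q c l hq hc).
  replace (/ (qpoch c q l * (1 - c * q ^ l)))
    with (/ qpoch c q l * (1 + c * q ^ l * / (1 - c * q ^ l)))
    by (field; now split).
  rewrite Cmod_mult. apply Rmult_le_compat_l; [apply Cmod_ge_0|].
  apply Rle_trans with (1 := Cmod_triangle _ _).
  rewrite Cmod_1, !Cmod_mult, Cmod_pow.
  assert (0 <= Cmod c * Cmod q ^ l)%R.
  { apply Rmult_le_pos; [apply Cmod_ge_0 | apply pow_le; lra]. }
  assert (h := hD l). nra.
Qed.

Lemma bounded_Cmult (u v : nat -> nat -> C) :
  (exists M, forall n k, (Cmod (u n k) <= M)%R) ->
  (exists M, forall n k, (Cmod (v n k) <= M)%R) ->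
  exists M, forall n k, (Cmod (u n k * v n k) <= M)%R.
Proof.
intros [M hM] [M' hM']. exists (M * M')%R. intros n k. rewrite Cmod_mult.
apply Rmult_le_compat; trivial; apply Cmod_ge_0.
Qed.

Lemma bounded_reindex (u : nat -> C) (f : nat -> nat -> nat) :
  (exists M, forall l, (Cmod (u l) <= M)%R) ->
  exists M, forall n k, (Cmod (u (f n k)) <= M)%R.
Proof. intros [M hM]. now exists M. Qed.

(** All three functions share this denominator, so only the boundedness of the numerator [u] remains
    to be checked for each. *)
Lemma has_dpseries_over_qpoch (q c : C) (u : nat -> nat -> C) :
  (0 < Cmod q)%R -> (Cmod q < 1)%R -> admissible q c ->
  (exists M, forall n k, (Cmod (u n k) <= M)%R) ->
  let A := fun n k =>
    u n k / (qpoch c q (n + k) * qpoch q q n * qpoch q q k) in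
  has_dpseries A (fun x y => dseries (fun n k => A n k * x ^ n * y ^ k)).
Proof.
intros hq0 hq1 hc hu A.
assert (hq : q <> 0) by now apply Cmod_gt_0.
assert (hqq := admissible_base q hq0 hq1).
assert (hA : exists M, forall n k, (Cmod (u n k *
  (/ qpoch c q (n + k) * (/ qpoch q q n * / qpoch q q k))) <= M)%R).
{ apply bounded_Cmult; trivial.
  apply bounded_Cmult.
  { apply (bounded_reindex (fun l => / qpoch c q l)).
    now apply inv_qpoch_bounded. }
  apply bounded_Cmult.
  - apply (bounded_reindex (fun l => / qpoch q q l) (fun n _ => n)).
    now apply inv_qpoch_bounded.
  - apply (bounded_reindex (fun l => / qpoch q q l) (fun _ k => k)).
    now apply inv_qpoch_bounded. }
destruct hA as [M hM].
apply has_dpseries_bounded with M. intros n k.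
unfold A.
replace (u n k / (qpoch c q (n + k) * qpoch q q n * qpoch q q k))
  with (u n k * (/ qpoch c q (n + k) * (/ qpoch q q n * / qpoch q q k))); trivial.
field. repeat split; now apply qpoch_neq_0.
Qed.

(** * Complex powers of [q] and expansions of the three functions *)

Lemma qpow_0 (L : C) : qpow L 0 = 1.
Proof.
unfold qpow, Cexp. rewrite Cmult_0_l. simpl.
now rewrite exp_0, cos_0, sin_0, Rmult_1_l, Rmult_0_r.
Qed.

Lemma Cexp_plus (z w : C) : Cexp (z + w) = Cexp z * Cexp w.
Proof.
unfold Cexp, Cmult, Re, Im. simpl. rewrite exp_plus, cos_plus, sin_plus.
f_equal; ring.
Qed.

(** With [Cexp L = q] this writes the denominator parameter as [q * g], where [g] is the power of
    [q] occurring in the operator with shift [c - 1]. *)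
Lemma qpow_pred (L c : C) : qpow L c = Cexp L * qpow L (c - 1).
Proof.
unfold qpow. rewrite <- Cexp_plus. f_equal. ring.
Qed.


Lemma Phi1_dpseries (q a b c : C) :
  (0 < Cmod q)%R -> (Cmod q < 1)%R -> admissible q c ->
  has_dpseries (fun n k => qpoch a q (n + k) * qpoch b q n
    / (qpoch c q (n + k) * qpoch q q n * qpoch q q k)) (Phi1 a b c q).
Proof.
intros hq0 hq1 hc.
apply (has_dpseries_over_qpoch q c
  (fun n k => qpoch a q (n + k) * qpoch b q n)); trivial.
apply bounded_Cmult.
- now apply bounded_reindex, qpoch_bounded.
- now apply (bounded_reindex _ (fun n _ => n)), qpoch_bounded.
Qed.

Lemma Phi2_dpseries (q a b c : C) :
  (0 < Cmod q)%R -> (Cmod q < 1)%R -> admissible q c ->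
  has_dpseries (fun n k => qpoch a q n * qpoch b q k
    / (qpoch c q (n + k) * qpoch q q n * qpoch q q k)) (Phi2 a b c q).
Proof.
intros hq0 hq1 hc.
apply (has_dpseries_over_qpoch q c
  (fun n k => qpoch a q n * qpoch b q k)); trivial.
apply bounded_Cmult.
- now apply (bounded_reindex _ (fun n _ => n)), qpoch_bounded.
- now apply (bounded_reindex _ (fun _ k => k)), qpoch_bounded.
Qed.

Lemma Phi3_dpseries (q a b : C) :
  (0 < Cmod q)%R -> (Cmod q < 1)%R -> admissible q b ->
  has_dpseries (fun n k => qpoch a q n
    / (qpoch b q (n + k) * qpoch q q n * qpoch q q k)) (Phi3 a b q).
Proof.
intros hq0 hq1 hc.
apply (has_dpseries_over_qpoch q b (fun n k => qpoch a q n)); trivial.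
now apply (bounded_reindex _ (fun n _ => n)), qpoch_bounded.
Qed.

(** * Coefficient identities under an index shift *)

(** This is [[0]_q = 0]: it gives the vanishing at index 0 that the shift of the series requires. *)
Lemma mult_qnumber_0 (q L z : C) :
  z * ((1 - qpow L 0 * q ^ 0) / (1 - q)) = 0.
Proof.
rewrite qpow_0. unfold Cdiv.
replace (1 - 1 * q ^ 0) with (RtoC 0) by (simpl; ring). ring.
Qed.

(** Raising [n] by one adds the factors [1 - q * g * q ^ (n + k)] and [1 - q * q ^ n] to the
    denominator. They are the numerators of the two q-numbers, so only [(1 - q) ^ 2] survives. The
    arbitrary [u] serves all three functions. *)
Lemma qpoch_denominator_shift_l (q g u : C) (n k : nat) :
  (0 < Cmod q)%R -> (Cmod q < 1)%R -> admissible q (q * g) ->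
  u / (qpoch (q * g) q (S n + k) * qpoch q q (S n) * qpoch q q k)
    * ((1 - g * q ^ (1 * S n + 1 * k)) / (1 - q))
    * ((1 - 1 * q ^ (1 * S n + 0 * k)) / (1 - q))
  = u / (qpoch (q * g) q (n + k) * qpoch q q n * qpoch q q k) / (1 - q) ^ 2.
Proof.
intros hq0 hq1 hc.
assert (hq : q <> 0) by now apply Cmod_gt_0.
assert (hqq := admissible_base q hq0 hq1).
replace (1 * S n + 1 * k)%nat with (S (n + k)) by lia.
replace (1 * S n + 0 * k)%nat with (S n) by lia.
assert (h1 := qpoch_neq_0 q _ (n + k) hq hc).
assert (h2 := admissible_neq_0 q _ (n + k) hq hc).
assert (h3 := qpoch_neq_0 q _ n hq hqq).
assert (h4 := admissible_neq_0 q _ n hq hqq).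
assert (h5 := qpoch_neq_0 q _ k hq hqq).
assert (h6 := admissible_neq_0 q _ 0 hq hqq).
simpl Nat.add. simpl qpoch. rewrite (Cpow_S _ (n + k)), (Cpow_S _ n).
change (1 - q * 1 <> 0) in h6. rewrite Cmult_1_r in h6.
(* The identity is rational in these powers and products, which become independent atoms for
   [field]. *)
generalize dependent (qpoch (q * g) q (n + k)).
generalize dependent (q ^ (n + k)).
generalize dependent (qpoch q q n).
generalize dependent (q ^ n).
generalize dependent (qpoch q q k).
intros. field. repeat split; trivial.
Qed.

(** The denominator is symmetric in [n] and [k], so exchanging the indices reduces this to the
    previous case. *)
Lemma qpoch_denominator_shift_r (q g u : C) (n k : nat) :
  (0 < Cmod q)%R -> (Cmod q < 1)%R -> admissible q (q * g) ->
  u / (qpoch (q * g) q (n + S k) * qpoch q q n * qpoch q q (S k))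
    * ((1 - g * q ^ (1 * n + 1 * S k)) / (1 - q))
    * ((1 - 1 * q ^ (0 * n + 1 * S k)) / (1 - q))
  = u / (qpoch (q * g) q (n + k) * qpoch q q n * qpoch q q k) / (1 - q) ^ 2.
Proof.
intros hq0 hq1 hc.
assert (h := qpoch_denominator_shift_l q g u k n hq0 hq1 hc).
rewrite (Nat.add_comm n (S k)), (Nat.add_comm n k).
rewrite (Nat.add_comm (1 * n)), (Nat.add_comm (0 * n)).
rewrite <- (Cmult_assoc (qpoch (q * g) q (S k + n))), (Cmult_comm (qpoch q q n)),
  (Cmult_assoc (qpoch (q * g) q (S k + n))).
rewrite <- (Cmult_assoc (qpoch (q * g) q (k + n))), (Cmult_comm (qpoch q q n)),
  (Cmult_assoc (qpoch (q * g) q (k + n))).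
exact h.
Qed.

(** Peeling off the operators one by one also instantiates the still unknown coefficient array. *)
Ltac solve_dpseries_hyp :=
  repeat match goal with |- has_dpseries _ (qTheta _ _ _ _ _ _) =>
    apply has_dpseries_qTheta; trivial end;
  eassumption.

(** After the denominator shift both sides contain the same reciprocal, which is abstracted.
    Unfolding one factor of the numerator products leaves an identity whose only denominators are
    powers of [1 - q]. *)
Ltac solve_coef hone den_shift :=
  let n := fresh "n" in let k := fresh "k" in
  intros n k; cbn beta; rewrite qpow_0, den_shift by trivial;
  rewrite ?Nat.mul_1_l, ?Nat.mul_0_l, ?Nat.add_0_r, ?Nat.add_0_l,
    ?Nat.add_succ_r, ?Nat.add_succ_l;
  cbn [qpoch]; unfold Cdiv;
  match goal with |- context [/ (?d * qpoch ?q ?q n * ?e)] =>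
    generalize (/ (d * qpoch q q n * e)) end;
  intros; field; exact hone.

Theorem theorem2p9 (q L : C) (hL : Cexp L = q)
    (hq0 : (0 < Cmod q)%R) (hq1 : (Cmod q < 1)%R) (alpha beta gamma : C) :
  (admissible q (qpow L gamma) ->
   let F1 := Phi1 (qpow L alpha) (qpow L beta) (qpow L gamma) q in
   let F2 := Phi2 (qpow L alpha) (qpow L beta) (qpow L gamma) q in
   forall x y : C, (Cmod x < 1)%R -> (Cmod y < 1)%R ->
     qTheta q L 1 0 0 (qTheta q L 1 1 (gamma - 1) F1) x y
       - x * qTheta q L 1 1 alpha (qTheta q L 1 0 beta F1) x y = 0
     /\ qTheta q L 0 1 0 (qTheta q L 1 1 (gamma - 1) F1) x y
       - y / (1 - q) * qTheta q L 1 1 alpha F1 x y = 0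
     /\ qTheta q L 1 0 0 (qTheta q L 1 1 (gamma - 1) F2) x y
       - x / (1 - q) * qTheta q L 1 0 alpha F2 x y = 0
     /\ qTheta q L 0 1 0 (qTheta q L 1 1 (gamma - 1) F2) x y
       - y / (1 - q) * qTheta q L 0 1 beta F2 x y = 0)
  /\
  (admissible q (qpow L beta) ->
   let F3 := Phi3 (qpow L alpha) (qpow L beta) q in
   forall x y : C, (Cmod x < 1)%R -> (Cmod y < 1)%R ->
     qTheta q L 1 0 0 (qTheta q L 1 1 (beta - 1) F3) x y
       - x / (1 - q) * qTheta q L 1 0 alpha F3 x y = 0
     /\ qTheta q L 0 1 0 (qTheta q L 1 1 (beta - 1) F3) x y
       - y / (1 - q) ^ 2 * F3 x y = 0).
Proof.
assert (hone : 1 - q <> 0).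
{ assert (h := admissible_neq_0 q q 0 (proj2 (Cmod_gt_0 q) hq0)
    (admissible_base q hq0 hq1)).
  now rewrite Cmult_1_r in h. }
split.
- intros hc F1 F2 x y hx hy.
  assert (hF1 := Phi1_dpseries q (qpow L alpha) (qpow L beta) _ hq0 hq1 hc).
  assert (hF2 := Phi2_dpseries q (qpow L alpha) (qpow L beta) _ hq0 hq1 hc).
  (* From here the functions are known only through their expansions. The parameter then becomes
     [q * qpow L (gamma - 1)], the form used by the shift identities. *)
  fold F1 in hF1. fold F2 in hF2. clearbody F1 F2.
  rewrite (qpow_pred L gamma), hL in hF1, hF2, hc.
  repeat split.
  (* The two operators after [x] supply both factors [/ (1 - q)], so the constant is 1 and is
     inserted as [x * 1]. *)
  + rewrite <- (Cmult_1_r x) at 2.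
    eapply (dpseries_mult_x_eq _ _ _ _ (1)); trivial.
    * solve_dpseries_hyp.
    * solve_dpseries_hyp.
    * intros m. apply mult_qnumber_0.
    * solve_coef hone qpoch_denominator_shift_l.
  (* A single operator follows [y]; the constant supplies the second factor [/ (1 - q)]. *)
  + eapply (dpseries_mult_y_eq _ _ _ _ (/ (1 - q))); trivial.
    * solve_dpseries_hyp.
    * solve_dpseries_hyp.
    * intros m. apply mult_qnumber_0.
    * solve_coef hone qpoch_denominator_shift_r.
  + eapply (dpseries_mult_x_eq _ _ _ _ (/ (1 - q))); trivial.
    * solve_dpseries_hyp.
    * solve_dpseries_hyp.
    * intros m. apply mult_qnumber_0.
    * solve_coef hone qpoch_denominator_shift_l.
  + eapply (dpseries_mult_y_eq _ _ _ _ (/ (1 - q))); trivial.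
    * solve_dpseries_hyp.
    * solve_dpseries_hyp.
    * intros m. apply mult_qnumber_0.
    * solve_coef hone qpoch_denominator_shift_r.
- intros hc F3 x y hx hy.
  assert (hF3 := Phi3_dpseries q (qpow L alpha) _ hq0 hq1 hc).
  fold F3 in hF3. clearbody F3.
  rewrite (qpow_pred L beta), hL in hF3, hc.
  split.
  + eapply (dpseries_mult_x_eq _ _ _ _ (/ (1 - q))); trivial.
    * solve_dpseries_hyp.
    * solve_dpseries_hyp.
    * intros m. apply mult_qnumber_0.
    * solve_coef hone qpoch_denominator_shift_l.
  (* No operator follows [y], so the constant carries both factors [/ (1 - q)]. *)
  + eapply (dpseries_mult_y_eq _ _ _ _ (/ (1 - q) ^ 2)); trivial.
    * solve_dpseries_hyp.
    * solve_dpseries_hyp.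
    * intros m. apply mult_qnumber_0.
    * solve_coef hone qpoch_denominator_shift_r.
Qed.
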